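(* Let $\mathcal{L}$ be a first-order language and let $\mathcal{M}$, $\mathcal{N}$ be $\mathcal{L}$-structures. If $f\colon \mathcal{M} \to \mathcal{N}$ is a strong homomorphism, then $$\frac{\mathcal{M}}{\ker f} \cong f(\mathcal{M}).$$
   Context: The universe of an $\mathcal{L}$-structure $\mathcal{M}$ is denoted $M$; constants are $0$-ary function symbols. A strong homomorphism $f\colon \mathcal{M} \to \mathcal{N}$ of $\mathcal{L}$-structures is a map $M \to N$ such that $f(F^{\mathcal{M}}(x_1,\dots,x_n)) = F^{\mathcal{N}}(f(x_1),\dots,f(x_n))$ for every $n$-ary function symbol $F$, and $R^{\mathcal{M}}(x_1,\dots,x_n) \iff R^{\mathcal{N}}(f(x_1),\dots,f(x_n))$ for every $n$-ary relation symbol $R$, for all $x_1,\dots,x_n \in M$. The image $f(\mathcal{M})$ is the substructure of $\mathcal{N}$ with universe $f(M)$. Isomorphisms $\cong$ are bijective strong homomorphisms. A congruence on $\mathcal{M}$ is an equivalence relation $\theta$ on $M$ such that whenever $(x_i,y_i) \in \theta$ for $1 \le i \leq n$: $(F^{\mathcal{M}}(x_1,\dots,x_n), F^{\mathcal{M}}(y_1,\dots,y_n)) \in \theta$ for every $n$-ary function symbol $F$, and $R^{\mathcal{M}}(x_1,\dots,x_n) \iff R^{\mathcal{M}}(y_1,\dots,y_n)$ for every $n$-ary relation symbol $R$. For a congruence $\theta$ on $\mathcal{M}$, the quotient $\mathcal{M}/\theta$ is the $\mathcal{L}$-structure with universe $M/\theta = \{[x]_\theta \mid x \in M\}$, $F^{\mathcal{M}/\theta}([x_1]_\theta,\dots,[x_n]_\theta)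 = [F^{\mathcal{M}}(x_1,\dots,x_n)]_\theta$ and $R^{\mathcal{M}/\theta}([x_1]_\theta,\dots,[x_n]_\theta) \iff R^{\mathcal{M}}(x_1,\dots,x_n)$. For a strong homomorphism $f$ with source $\mathcal{M}$, $\ker f = \{\, (x,y) \in M^2 \mid f(x) = f(y) \,\}$, which is a congruence on $\mathcal{M}$. *)

(* Defs.v *)
From Corelib Require Export RelationClasses.
From mathcomp Require Export all_boot.
From mathcomp Require Export boolp classical_sets.

Set Implicit Arguments.
Unset Strict Implicit.
Unset Printing Implicit Defensive.

Local Open Scope classical_set_scope.

(* Constants are the function symbols of arity 0. *)
Record language := Language {
  fun_symbol : Type;
  rel_symbol : Type;
  fun_arity : fun_symbol -> nat;
  rel_arity : rel_symbol -> nat }.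

(* The universe is not required to be nonempty. *)
Record structure (L : language) := Structure {
  universe :> Type;
  interp_fun : forall F : fun_symbol L, (fun_arity F).-tuple universe -> universe;
  interp_rel : forall R : rel_symbol L, (rel_arity R).-tuple universe -> Prop }.

Arguments interp_fun {L} M F x : rename.
Arguments interp_rel {L} M R x : rename.

Record strong_hom (L : language) (M N : structure L) (f : M -> N) : Prop := StrongHom {
  strong_hom_fun : forall (F : fun_symbol L) (x : (fun_arity F).-tuple M),
    f (interp_fun M F x) = interp_fun N F (map_tuple f x);
  strong_hom_rel : forall (R : rel_symbol L) (x : (rel_arity R).-tuple M),
    interp_rel M R x <-> interp_rel N R (map_tuple f x) }.

Definition isomorphic (L : language) (M N : structure L) : Prop :=
  exists2 h : M -> N, strong_hom h & bijective h.

Notation "M ≅ N" := (isomorphic M N) (at level 70, no associativity).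

Section Substructure.
Variables (L : language) (N : structure L) (S : set N).

Definition closed_under_funs : Prop :=
  forall (F : fun_symbol L) (y : (fun_arity F).-tuple N),
    (forall i, S (tnth y i)) -> S (interp_fun N F y).

Hypothesis S_closed : closed_under_funs.

Lemma substructure_fun_subproof (F : fun_symbol L) (y : (fun_arity F).-tuple S) :
  S (interp_fun N F (map_tuple val y)).
Proof. by apply: S_closed => i; rewrite tnth_map; exact/set_mem/valP. Qed.

Definition substructure : structure L := {|
  universe := S;
  interp_fun := fun F y => SigSub (mem_set (substructure_fun_subproof (F := F) y));
  interp_rel := fun R y => interp_rel N R (map_tuple val y) |}.

End Substructure.

Lemma range_closed (L : language) (M N : structure L) (f : M -> N) :
  strong_hom f -> closed_under_funs (range f).
Proof.
move=> [f_fun _] F y y_im.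
have fy i : exists x, f x = tnth y i by have [x _ <-] := y_im i; exists x.
pose x := [tuple sval (cid (fy i)) | i < fun_arity F].
have -> : y = map_tuple f x.
  by apply: eq_from_tnth => i; rewrite tnth_map tnth_mktuple; case: cid.
by rewrite -f_fun; exists (interp_fun M F x).
Qed.

Definition image_structure (L : language) (M N : structure L) (f : M -> N)
  (hf : strong_hom f) : structure L := substructure (range_closed hf).

Record congruence (L : language) (M : structure L) (theta : M -> M -> Prop) : Prop :=
  Congruence {
    congruence_equiv : Equivalence theta;
    congruence_fun : forall (F : fun_symbol L) (x y : (fun_arity F).-tuple M),
      (forall i, theta (tnth x i) (tnth y i)) ->
      theta (interp_fun M F x) (interp_fun M F y);
    congruence_rel : forall (R : rel_symbol L) (x y : (rel_arity R).-tuple M),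
      (forall i, theta (tnth x i) (tnth y i)) ->
      (interp_rel M R x <-> interp_rel M R y) }.

Section Quotient.
Variables (L : language) (M : structure L) (theta : M -> M -> Prop).

Definition classes : set (set M) := range (fun x => [set y | theta x y]).

Definition class_of (x : M) : classes :=
  SigSub (mem_set (imageT (fun x => [set y | theta x y]) x)).

Lemma class_of_surj (c : classes) : exists x, class_of x = c.
Proof. by have [x _ xc] := set_mem (valP c); exists x; exact: val_inj. Qed.

Definition repr_class (c : classes) : M := sval (cid (class_of_surj c)).

Lemma repr_classK : cancel repr_class class_of.
Proof. by move=> c; rewrite /repr_class; case: cid. Qed.

Hypothesis theta_congr : congruence theta.

Lemma class_of_eqP (x y : M) : class_of x = class_of y <-> theta x y.
Proof.
have [refl sym trans] := congruence_equiv theta_congr; split=> [|xy].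
  by move=> /(congr1 val)/= /predeqP/(_ y)[_]; apply; exact: refl.
apply/val_inj/predeqP => z /=; split; first by apply: trans; exact: sym.
exact: trans.
Qed.

(* Interpretations are computed on chosen representatives; since theta is a
   congruence the choice is immaterial, see quotient_funE and quotient_relE. *)
Definition quotient of congruence theta : structure L := {|
  universe := classes;
  interp_fun := fun F c => class_of (interp_fun M F (map_tuple repr_class c));
  interp_rel := fun R c => interp_rel M R (map_tuple repr_class c) |}.

Lemma theta_repr_class (n : nat) (x : n.-tuple M) (i : 'I_n) :
  theta (tnth (map_tuple repr_class (map_tuple class_of x)) i) (tnth x i).
Proof. by rewrite !tnth_map; apply/class_of_eqP; rewrite repr_classK. Qed.

Lemma quotient_funE (F : fun_symbol L) (x : (fun_arity F).-tuple M) :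
  interp_fun (quotient theta_congr) F (map_tuple class_of x) =
  class_of (interp_fun M F x).
Proof.
by apply/class_of_eqP/(congruence_fun theta_congr); exact: theta_repr_class.
Qed.

Lemma quotient_relE (R : rel_symbol L) (x : (rel_arity R).-tuple M) :
  interp_rel (quotient theta_congr) R (map_tuple class_of x) <->
  interp_rel M R x.
Proof. by apply: (congruence_rel theta_congr); exact: theta_repr_class. Qed.

End Quotient.

Definition ker (L : language) (M N : structure L) (f : M -> N) : M -> M -> Prop :=
  fun x y => f x = f y.

Lemma ker_congruence (L : language) (M N : structure L) (f : M -> N) :
  strong_hom f -> congruence (ker f).
Proof.
move=> [f_fun f_rel].
have map_eq n (x y : n.-tuple M) : (forall i, ker f (tnth x i) (tnth y i)) ->
    map_tuple f x = map_tuple f y.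
  by move=> xy; apply: eq_from_tnth => i; rewrite !tnth_map; exact: xy.
split.
- by split=> [x|x y|x y z]; rewrite /ker => // ->.
- by move=> F x y /map_eq xy; rewrite /ker !f_fun xy.
- by move=> R x y /map_eq xy; rewrite !f_rel xy.
Qed.

(* Main.v *)
Require Import Defs.

(** The class of [x] goes to [f x]: well defined and injective because two points share a class
    exactly when [f] agrees on them, and onto the image by construction. The quotient is interpreted
    on representatives, so preservation reduces to that for [f]; [ker_repr_class] removes the
    choice. *)

Lemma ker_repr_class (L : language) (M N : structure L) (f : M -> N)
    (hf : strong_hom f) (x : M) :
  f (repr_class (class_of (ker f) x)) = f x.
Proof. by apply/(class_of_eqP (ker_congruence hf)); rewrite repr_classK. Qed.

Theorem theorem4p1 (L : language) (M N : structure L) (f : M -> N)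
    (hf : strong_hom f) :
  quotient (ker_congruence hf) ≅ image_structure hf.
Proof.
pose h (c : quotient (ker_congruence hf)) : image_structure hf :=
  SigSub (mem_set (imageT f (repr_class c))).
have map_h n (c : n.-tuple (quotient (ker_congruence hf))) :
    map_tuple val (map_tuple h c) = map_tuple f (map_tuple (@repr_class _ _ _) c).
  by apply: eq_from_tnth => i; rewrite !tnth_map.
exists h.
  split=> [F c|R c].
    (* The representative chosen for the class of a function value may differ from that value, but
       [f] agrees on both. *)
    by apply: val_inj; rewrite /= map_h (ker_repr_class _ _ _ _ hf) (strong_hom_fun hf).
  by rewrite /= map_h; exact: (strong_hom_rel hf).
have preimage (y : image_structure hf) : exists x, f x = val y.
  by have [x _ fx] := set_mem (valP y); exists x.
(* The inverse takes the class of a chosen preimage; all preimages of [y] lie in one class. *)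
exists (fun y => class_of (ker f) (sval (cid (preimage y)))) => [c|y].
  case: cid => x /= fx; rewrite -[RHS]repr_classK.
  by apply/(class_of_eqP (ker_congruence hf)).
by apply: val_inj; rewrite /= (ker_repr_class _ _ _ _ hf); case: cid.
Qed.
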